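(* For each $s \in \omega$, there is a special cycle--free ${}^{<\omega_1}\omega$-Hajnal--Máté graph without odd cycles of length at most $2s+1$.
   Context: The background theory is ZFC. A tree is a partial order $(T,<_T)$ such that for every $t \in T$ the set $\{s \in T \mid s <_T t\}$ is well-ordered by $<_T$. For an ordinal $\beta$, $T_\beta$ is the set of $t \in T$ such that $\{s \in T \mid s<_T t\}$ has order type $\beta$, and $T_{<\beta} = \bigcup_{\alpha<\beta} T_\alpha$. The height of $T$ is the least $\beta$ with $T_\beta = \emptyset$. The comparability graph of $T$ is the graph on vertex set $T$ in which $\{s,t\}$ is an edge if and only if $s <_T t$ or $t <_T s$. ${}^{<\omega_1}\omega$ denotes the tree of all functions from a countable ordinal to $\omega$, ordered by end-extension ($f <_T g$ iff $f \subsetneq g$); it has height $\omega_1$. A graph is a pair $(X,E)$ with $E \subseteq [X]^2$. Its chromatic number is the least cardinal $\mu$ such that there is $c : X \to \mu$ with $c(u) \ne c(v)$ whenever $\{u,v\} \in E$. For a tree $T$ of height $\omega_1$, a graph $G = (T,E)$ is a $T$-Hajnal--Máté graph ($T$-HM graph) if it is a subgraph of the comparability graph of $T$, its chromatic number is uncountable, and for all $\alpha<\beta<\omega_1$ and $t \in T_\beta$ the set $\{s \in T_{<\alpha} \mid \{s,t\} \in E\}$ is finite. For a natural number $n \ge 3$ and an injective sequence $(x_0,\dots,x_{n-1})$ of vertices, $(x_0,\dots,x_{n-1},x_0)$ is a cycle of length $n$ if $\{x_i,x_{i+1}\} \in E$ for all $i<n-1$ and $\{x_{n-1},x_0\} \in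 E$. An odd cycle is a cycle of odd length. A cycle $\langle x_0,\dots,x_{n-1},x_0\rangle$ in a graph on a tree $T$ is called special if there is $r<n$ such that $x_{i+1} <_T x_i$ for all $i<r$ and $x_i <_T x_{i+1}$ for all $r \le i < n$, where $x_n := x_0$. A graph is special cycle--free if it contains no special cycles. *)

(* Defs.v *)
From mathcomp Require Import all_boot.
From mathcomp Require Import boolp classical_sets functions cardinality wochoice.

Set Implicit Arguments.
Unset Strict Implicit.
Unset Printing Implicit Defensive.

Local Open Scope classical_set_scope.
Local Open Scope card_scope.

Definition well_ordered {T : Type} (lt : T -> T -> Prop) (A : set T) : Prop :=
  [/\ forall x, A x -> ~ lt x x,
      forall x y z, A x -> A y -> A z -> lt x y -> lt y z -> lt x z,
      forall x y, A x -> A y -> [\/ lt x y, x = y | lt y x]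
    & forall B : set T, B `<=` A -> B !=set0 ->
        exists2 m, B m & forall y, B y -> m = y \/ lt m y].

Definition order_isomorphic {T U : Type}
    (A : set T) (ltT : T -> T -> Prop) (B : set U) (ltU : U -> U -> Prop) : Prop :=
  exists2 f : T -> U, set_bij A B f &
    forall x y, A x -> A y -> (ltT x y <-> ltU (f x) (f y)).

(** The ordinal omega_1.  In a fixed well-ordering of the power set of nat, the
    points with countably many predecessors form a well-order that is uncountable
    while all its proper initial segments are countable ([omega1_well_ordered],
    [omega1_uncountable], [omega1_lt_countable]); up to unique isomorphism this
    is omega_1, and its points are the countable ordinals. *)
Definition powerset_wo : {R : rel (set nat) | well_order R} :=
  well_ordering_principle (set nat : eqType).

Definition omega1 : Type := {x : set nat | countable [set y | sval powerset_wo y x]}.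

Definition omega1_lt (a b : omega1) : Prop :=
  sval powerset_wo (sval a) (sval b) /\ a <> b.

(** As a von Neumann ordinal, [b] is the set of its predecessors. *)
Definition omega1_seg (b : omega1) : set omega1 := [set a | omega1_lt a b].

Section Omega1Theory.

Let R := sval powerset_wo.

Let R_wo : well_order R. Proof. exact: (svalP powerset_wo). Qed.

Let R_woT : wo_chain R predT.
Proof. by move=> A _; exact: R_wo. Qed.

Let R_refl x : R x x.
Proof. by apply: (wo_chain_reflexive R_woT). Qed.

Let R_anti x y : R x y -> R y x -> x = y.
Proof.
by move=> xy yx; apply: (wo_chain_antisymmetric R_woT) => //; rewrite xy yx.
Qed.

Let R_total x y : R x y || R y x.
Proof. by apply: (wo_chainW R_woT). Qed.

Let R_min (B : set (set nat)) : B !=set0 -> exists2 m, B m & forall y, B y -> R m y.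
Proof.
move=> [x Bx]; have [|m [[Bm mP] _]] := R_wo (A := mem B).
  by exists x; rewrite inE.
by exists m => [|y By]; [move: Bm; rewrite inE | apply: mP; rewrite inE].
Qed.

Let R_trans x y z : R x y -> R y z -> R x z.
Proof.
move=> xy yz.
have [|m mxyz mP] := @R_min [set x; y; z]; first by exists x; left; left.
have mx : R m x by apply: mP; left; left.
have my : R m y by apply: mP; left; right.
have mz : R m z by apply: mP; right.
case: mxyz => [[|]|] me; rewrite me in mx my mz => //.
- by rewrite -(R_anti xy mx) in yz *.
- by rewrite -(R_anti yz my).
Qed.

Let sval_inj (a b : omega1) : sval a = sval b -> a = b.
Proof.
case: a b => [a pa] [b pb] /= ab; rewrite -ab in pb *.
by congr exist; exact: Prop_irrelevance.
Qed.

Lemma omega1_ltNge (a b : omega1) : ~ omega1_lt a b -> b = a \/ omega1_lt b a.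
Proof.
move=> nab; have [->|ba] := pselect (b = a); first by left.
right; split=> //; have /orP[ab|//] := R_total (sval a) (sval b).
by case: nab; split=> // ab'; apply: ba.
Qed.

Lemma omega1_well_ordered : well_ordered omega1_lt [set: omega1].
Proof.
split=> [x _ [_ //]|x y z _ _ _ [xy nxy] [yz nyz]|x y _ _|B _ [b Bb]].
- split; first exact: R_trans yz.
  by move=> xz; apply: nxy; apply: sval_inj; apply: R_anti => //; rewrite xz.
- have [xy|/omega1_ltNge[->|]] := pselect (omega1_lt x y);
    [exact: Or31|exact: Or32|exact: Or33].
- have [|m [m' Bm' m'm] mP] := @R_min (sval @` B); first by exists (sval b), b.
  exists m' => // y By; have [->|ne] := pselect (m' = y); first by left.
  by right; split=> //; rewrite m'm; apply: mP; exists y.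
Qed.

Let powerset_uncountable : ~ countable [set: set nat].
Proof.
move=> /countable_injP[f finj].
pose D : set nat := [set n | exists2 X : set nat, f X = n & ~ X n].
have [DfD|nDfD] := pselect (D (f D)).
  have [X fXD] := DfD; have -> : X = D by apply: finj => //; rewrite inE.
  by [].
by apply: (nDfD); exists D.
Qed.

Lemma omega1_uncountable : ~ countable [set: omega1].
Proof.
move=> Wc; pose W : set (set nat) := sval @` [set: omega1].
have Wc' : countable W by apply: sub_countable Wc; apply: card_image_le.
have [[x nWx]|allW] := pselect (exists x, ~ W x); last first.
  apply: powerset_uncountable; apply: sub_countable Wc'; apply: subset_card_le.
  by move=> x _; apply: contrapT => nWx; apply: allW; exists x.
have [|m nWm mP] := @R_min (~` W); first by exists x.
apply: nWm; have cm : countable [set y | R y m].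
  apply: (@sub_countable _ _ _ (W `|` [set m])).
    apply: subset_card_le => y ym; have [|nWy] := pselect (W y); first by left.
    by right; apply: R_anti => //; apply: mP.
  have -> : W `|` [set m] = \bigcup_(b in [set: bool]) (if b then W else [set m]).
    apply/seteqP; split=> [y [Wy|ym]|y [[] _ ?]]; by
      [exists true|exists false|left|right].
  by apply: bigcup_countable => // -[] _ //; apply: countable1.
by exists (exist _ m cm).
Qed.

Lemma omega1_lt_countable (b : omega1) : countable (omega1_seg b).
Proof.
have /countable_injP[f finj] := svalP b.
apply/countable_injP; exists (f \o sval) => x y; rewrite !inE => xb yb fxy.
by apply: sval_inj; apply: finj fxy; rewrite inE; [case: xb|case: yb].
Qed.

End Omega1Theory.

Record tree := Tree {
  node :> Type;
  tree_lt : node -> node -> Prop;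
  tree_irr : forall t, ~ tree_lt t t;
  tree_trans : forall s t u, tree_lt s t -> tree_lt t u -> tree_lt s u;
  tree_wo : forall t, well_ordered tree_lt [set s | tree_lt s t]
}.

Definition preds (T : tree) (t : T) : set T := [set s | tree_lt s t].

Definition level (T : tree) (b : omega1) : set T :=
  [set t | order_isomorphic (preds t) (@tree_lt T) (omega1_seg b) omega1_lt].

Arguments level : clear implicits.

Definition levels_below (T : tree) (b : omega1) : set T :=
  \bigcup_(a in omega1_seg b) level T a.

Arguments levels_below : clear implicits.

(** The levels below omega_1 are nonempty, and level omega_1 is empty. *)
Definition height_omega1 (T : tree) : Prop :=
  (forall b, level T b !=set0) /\
  (forall t : T,
    ~ order_isomorphic (preds t) (@tree_lt T) [set: omega1] omega1_lt).

Definition tree_comparable (T : tree) (s t : T) : Prop :=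
  tree_lt s t \/ tree_lt t s.

(** The nodes are the functions from a countable ordinal to nat, encoded as partial
    functions on omega_1 whose domain is a proper initial segment, so that
    inclusion of graphs makes sense. *)
Definition pdom (f : omega1 -> option nat) : set omega1 := [set a | f a <> None].

Definition seq_node : Type :=
  {f : omega1 -> option nat | exists b, pdom f = omega1_seg b}.

Definition extended_by (f g : seq_node) : Prop :=
  forall a n, sval f a = Some n -> sval g a = Some n.

Definition seq_lt (f g : seq_node) : Prop := extended_by f g /\ f <> g.

Section SeqTree.

Let wo := omega1_well_ordered.

Let lt_irr a : ~ omega1_lt a a.
Proof. by case: wo => irr _ _ _; apply: irr. Qed.

Let lt_trans a b c : omega1_lt a b -> omega1_lt b c -> omega1_lt a c.
Proof. by case: wo => _ tr _ _; apply: tr. Qed.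

Let lt_total a b : [\/ omega1_lt a b, a = b | omega1_lt b a].
Proof. by case: wo => _ _ tot _; apply: tot. Qed.

Let seq_inj (f g : seq_node) : sval f = sval g -> f = g.
Proof.
case: f g => [f pf] [g pg] /= fg; rewrite -fg in pg *.
by congr exist; exact: Prop_irrelevance.
Qed.

Let ext_anti f g : extended_by f g -> extended_by g f -> f = g.
Proof.
move=> fg gf; apply/seq_inj/funext => a.
case fa: (sval f a) => [n|]; first by rewrite (fg _ _ fa).
by case ga: (sval g a) => [n|] //; rewrite (gf _ _ ga) in fa.
Qed.

Let ext_trans f g h : extended_by f g -> extended_by g h -> extended_by f h.
Proof. by move=> fg gh a n /fg/gh. Qed.

Lemma seq_lt_irr f : ~ seq_lt f f. Proof. by case. Qed.

Lemma seq_lt_trans f g h : seq_lt f g -> seq_lt g h -> seq_lt f h.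
Proof.
move=> [fg nfg] [gh ngh]; split; first exact: ext_trans gh.
by move=> fh; apply: nfg; apply: ext_anti => //; rewrite fh.
Qed.

Let len (f : seq_node) : omega1 := sval (cid (svalP f)).

Let lenE f a : sval f a <> None <-> omega1_lt a (len f).
Proof.
rewrite /len; case: (cid _) => b /= fb.
by rewrite -[_ <> _]/(pdom (sval f) a) fb.
Qed.

Let restr_subproof (f : omega1 -> option nat) b :
    omega1_seg b `<=` pdom f ->
  exists c, pdom (fun a => if `[<omega1_lt a b>] then f a else None) = omega1_seg c.
Proof.
move=> bf; exists b; apply/seteqP; split=> a; rewrite /pdom /=.
  by case: asboolP.
by move=> ab; rewrite asboolT //; apply: bf.
Qed.

Let restr f b bf : seq_node := exist _ _ (@restr_subproof f b bf).

Let len_restr f b bf : len (@restr f b bf) = b.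
Proof.
have E a : omega1_lt a (len (@restr f b bf)) <-> omega1_lt a b.
  rewrite -lenE /=; split; first by case: asboolP.
  by move=> ab; rewrite asboolT //; apply: bf.
have [lb|//|bl] := lt_total (len (@restr f b bf)) b.
  by have /E/lt_irr := lb.
by have /E/lt_irr := bl.
Qed.

Let ltP f h : seq_lt f h <-> extended_by f h /\ omega1_lt (len f) (len h).
Proof.
split=> [[fh nfh]|[fh lfh]]; split=> //; last first.
  by move=> fhE; move: lfh; rewrite fhE; apply: lt_irr.
have sub a : omega1_lt a (len f) -> omega1_lt a (len h).
  rewrite -!lenE; case fa: (sval f a) => [n|] // _.
  by rewrite (fh _ _ fa).
have [//|fhl|/sub/lt_irr//] := lt_total (len f) (len h).
case: nfh; apply: ext_anti => // a n ha.
have : sval f a <> None by rewrite lenE fhl -lenE ha.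
case fa: (sval f a) => [m|] // _.
by have := fh _ _ fa; rewrite ha => -[->].
Qed.

Let ext_len f g h : extended_by f h -> extended_by g h ->
  (omega1_lt (len f) (len g) \/ len f = len g) -> extended_by f g.
Proof.
move=> fh gh fg a n fa.
have af : omega1_lt a (len f) by rewrite -lenE fa.
have : sval g a <> None.
  by rewrite lenE; case: fg => [|<-//]; apply: lt_trans.
case ga: (sval g a) => [m|] // _.
by have := fh _ _ fa; rewrite (gh _ _ ga) => -[->].
Qed.

Let len_inj f g h : extended_by f h -> extended_by g h -> len f = len g -> f = g.
Proof. by move=> fh gh fg; apply: ext_anti; apply: ext_len; eauto. Qed.

Lemma seq_lt_wo t : well_ordered seq_lt [set s | seq_lt s t].
Proof.
split=> [x _|x y z _ _ _|x y [xt _] [yt _]|B Bt [b Bb]].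
- exact: seq_lt_irr.
- exact: seq_lt_trans.
- have [xy|xy|yx] := lt_total (len x) (len y).
  + by apply: Or31; apply/ltP; split=> //; apply: ext_len xt yt _; left.
  + by apply: Or32; apply: len_inj xt yt xy.
  + by apply: Or33; apply/ltP; split=> //; apply: ext_len yt xt _; left.
- have [_ _ _ mn] := wo.
  have [||_ [m Bm <-] mP] := mn (len @` B); [by []|by exists (len b), b|].
  exists m => // y By; have [mt _] := Bt _ Bm; have [yt _] := Bt _ By.
  case: (mP (len y)) => [|my|my]; first by exists y.
    by left; apply: len_inj mt yt my.
  by right; apply/ltP; split=> //; apply: ext_len mt yt _; left.
Qed.

Definition seq_tree : tree := Tree seq_lt_irr seq_lt_trans seq_lt_wo.

Let preds_iso (t : seq_tree) :
  order_isomorphic (preds t) (@tree_lt seq_tree) (omega1_seg (len t)) omega1_lt.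
Proof.
exists len; first split.
- by move=> s /ltP[].
- by move=> s u; rewrite !inE => -[st _] [ut _]; apply: len_inj st ut.
- move=> b bt.
  have bd : omega1_seg b `<=` pdom (sval t).
    by move=> a ab; apply/lenE; apply: lt_trans bt.
  exists (restr bd); last exact: len_restr.
  apply/ltP; split; last by rewrite len_restr.
  by move=> a n /=; case: asboolP.
- move=> s u [st _] [ut _]; split=> [/ltP[]//|su]; apply/ltP; split=> //.
  by apply: ext_len st ut _; left.
Qed.

Lemma seq_tree_height : height_omega1 seq_tree.
Proof.
split=> [b|t [f [_ _ fsurj] _]].
  have bd : omega1_seg b `<=` pdom (fun _ => Some 0) by [].
  by exists (restr bd); rewrite /level /= -[b in omega1_seg b](len_restr bd);
     exact: preds_iso.
apply: omega1_uncountable.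
have ct : countable (preds t).
  have [g' [gfun g'inj _] _] := preds_iso t.
  have /countable_injP[h hinj] := omega1_lt_countable (len t).
  apply/countable_injP; exists (h \o g') => x y.
  rewrite !inE => xt yt /hinj; rewrite !inE => e.
  by apply: g'inj; rewrite ?inE //; apply: e; apply: gfun.
apply: (@sub_countable _ _ _ (f @` preds t)).
  by apply: subset_card_le => a /fsurj.
by apply: sub_countable ct; apply: card_image_le.
Qed.

End SeqTree.

Record graph (X : Type) := Graph {
  adj : X -> X -> Prop;
  adj_sym : forall u v, adj u v -> adj v u;
  adj_irr : forall u, ~ adj u u
}.

Definition colorable {X : Type} (G : graph X) (M : Type) : Prop :=
  exists c : X -> M, forall u v, adj G u v -> c u <> c v.

(** Cardinals are represented by types, compared by injections, so the least
    cardinal is determined up to equipotence: [M] realises the chromatic number. *)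
Definition chromatic_number {X : Type} (G : graph X) (M : Type) : Prop :=
  colorable G M /\ forall N : Type, colorable G N -> [set: M] #<= [set: N].

(** Used for trees of height omega_1; see [seq_tree_height]. *)
Definition hajnal_mate (T : tree) (G : graph T) : Prop :=
  [/\ forall s t, adj G s t -> tree_comparable s t,
      exists M : Type, chromatic_number G M /\ ~ countable [set: M]
    & forall a b : omega1, omega1_lt a b -> forall t, level T b t ->
        finite_set [set s | levels_below T a s /\ adj G s t]].

(** [ordS] is the successor in the cyclic order of ['I_n], so that the case
    [i = n - 1] is the closing edge from [x_(n-1)] to [x_0]. *)
Definition is_cycle {X : Type} (G : graph X) (n : nat) (x : 'I_n -> X) : Prop :=
  [/\ 3 <= n, injective x & forall i, adj G (x i) (x (ordS i))].

Definition special_cycle (T : tree) (G : graph T) (n : nat) (x : 'I_n -> T) : Prop :=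
  is_cycle G x /\
  exists2 r : nat, r < n &
    (forall i : 'I_n, i < r -> tree_lt (x (ordS i)) (x i)) /\
    (forall i : 'I_n, r <= i -> tree_lt (x i) (x (ordS i))).

Definition special_cycle_free (T : tree) (G : graph T) : Prop :=
  ~ exists n (x : 'I_n -> T), special_cycle G x.

(* Main.v *)
(** A node of the tree is read as a sequence of finite sets of labelled pointers to
    earlier ordinals.  The pointers that recur cofinally below a node [y] single out
    a set of nodes below [y], its ladder, and a position at which an increasing
    [m]-tuple of ordinals below [y] is recorded.  A node [u] of the ladder is joined
    to [y] when the tuple of [u] interleaves that of [y] with offset [k], as in a
    Specker graph, and ends above all earlier ladder elements.  Interleaving rules
    out closed walks of odd length at most [2k+1].  As tuples grow along descending
    paths, the paths descending from distinct ladder elements of [y] never meet, so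
    there are no special cycles.

    For uncountable chromaticity, call [w] a pure extension of [v] if no ladder
    pointer of [w] crosses [v].  Given a countable colouring, a colour is good if, in
    the finite game in which a tuple is chosen entry by entry and then a node
    carrying it, the choices can always be made, above every pure extension, so that
    the node gets that colour.  One builds a node [t] whose tuple entries are chosen
    above nodes deciding which colours are still possible, so the colour of [t] is
    good.  In parallel a tuple is built for each of the countably many good colours,
    interleaving that of [t]; these are completed one by one into the ladder of [t],
    which thus meets every good colour, in particular that of [t]. *)
Require Import Defs.
From HB Require Import structures.
From mathcomp Require Import all_boot all_order.
From mathcomp Require Import zify.
From mathcomp Require Import boolp classical_sets functions cardinality.

Set Implicit Arguments.
Unset Strict Implicit.
Unset Printing Implicit Defensive.

Import Order.TTheory.
Local Open Scope classical_set_scope.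

(** * The linear order of the countable ordinals *)

HB.instance Definition _ := gen_eqMixin omega1.
HB.instance Definition _ := gen_choiceMixin omega1.

Fact omega1_display : Order.disp_t. Proof. exact: (Order.Disp tt tt). Qed.

Definition omega1_ltb (a b : omega1) : bool := `[< omega1_lt a b >].

Fact omega1_ltb_irr : irreflexive omega1_ltb.
Proof. by move=> a; apply/asboolPn; case: omega1_well_ordered => irr _ _ _; apply: irr. Qed.

Fact omega1_ltb_trans : transitive omega1_ltb.
Proof.
move=> b a c /asboolP ab /asboolP bc; apply/asboolP.
by case: omega1_well_ordered => _ tr _ _; apply: tr bc.
Qed.

HB.instance Definition _ := @Order.Lt_isPOrder.Build omega1_display omega1
  omega1_ltb omega1_ltb_irr omega1_ltb_trans.

Fact omega1_le_total : total (<=%O : rel omega1).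
Proof.
move=> a b; have [/asboolP ab|->|/asboolP ba] : [\/ omega1_lt a b, a = b | omega1_lt b a].
  by case: omega1_well_ordered => _ _ tot _; apply: tot.
- by rewrite (@ltW _ omega1 a b ab).
- by rewrite lexx.
- by rewrite (@ltW _ omega1 b a ba) orbT.
Qed.

HB.instance Definition _ :=
  @Order.POrder_isTotal.Build omega1_display omega1 omega1_le_total.

Lemma omega1_ltE (a b : omega1) : omega1_lt a b <-> (a < b)%O.
Proof. by split=> [/asboolP|/asboolP]. Qed.

Lemma omega1_min (P : set omega1) : P !=set0 ->
  exists2 m, P m & forall a, P a -> (m <= a)%O.
Proof.
move=> P0; case: omega1_well_ordered => _ _ _ /(_ P (fun _ _ => I) P0)[m Pm mP].
by exists m => // a /mP[->//|/omega1_ltE/ltW].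
Qed.

Lemma omega1_wf : well_founded omega1_lt.
Proof.
move=> a; apply: contrapT => na.
have [|m nm mP] := @omega1_min (fun b => ~ Acc omega1_lt b); first by exists a.
apply: nm; constructor=> b /omega1_ltE bm; apply: contrapT => /mP.
by rewrite leNgt bm.
Qed.

(** An unbounded sequence would cover [omega1] by countably many countable initial segments. *)
Lemma omega1_bounded (f : nat -> omega1) : exists b, forall i, (f i < b)%O.
Proof.
apply: contrapT => nb; apply: omega1_uncountable.
pose F i := [set a : omega1 | (a <= f i)%O].
have cF : countable (\bigcup_(i in [set: nat]) F i).
  apply: bigcup_countable => // i _.
  have -> : F i = \bigcup_(j in [set: bool]) if j then omega1_seg (f i) else [set f i].
    apply/seteqP; split=> a; rewrite /F /omega1_seg /= le_eqVlt.
      by case/orP=> [/eqP ->|/omega1_ltE]; [exists false|exists true].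
    by case=> [[_ /omega1_ltE ->|_ ->]]; rewrite ?eqxx ?orbT.
  apply: bigcup_countable => // -[] _; [exact: omega1_lt_countable|exact: countable1].
apply: sub_countable cF; apply: subset_card_le => a _.
have /existsNP[i /negP] : ~ forall i, (f i < a)%O by move=> fa; apply: nb; exists a.
by rewrite -leNgt => afi; exists i.
Qed.

Lemma omega1_sup (f : nat -> omega1) :
  exists2 b, forall i, (f i <= b)%O & forall a, (a < b)%O -> exists i, (a < f i)%O.
Proof.
have [b0 fb0] := omega1_bounded f.
have [|m fm mP] := @omega1_min (fun b => forall i, (f i <= b)%O).
  by exists b0 => i; apply: ltW.
exists m => // a am; have /existsNP[i /negP] : ~ forall i, (f i <= a)%O.
  by move/mP; rewrite leNgt am.
by rewrite -ltNge; exists i.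
Qed.

Lemma omega1_succ (a : omega1) :
  exists2 b, (a < b)%O & forall x, (x < b)%O -> (x <= a)%O.
Proof.
have [b0 /(_ 0) ab0] := omega1_bounded (fun=> a).
have [|m am mP] := @omega1_min [set b | (a < b)%O]; first by exists b0.
by exists m => // x xm; rewrite leNgt; apply/negP => /mP; rewrite leNgt xm.
Qed.

Lemma omega1_zero : exists b : omega1, forall x, (b <= x)%O.
Proof.
have [|m _ mP] := @omega1_min setT; last by exists m => x; apply: mP.
apply/set0P/eqP => T0; apply: omega1_uncountable; rewrite T0; exact: countable0.
Qed.

(** * Nodes as sequences of natural numbers *)

Definition len (f : seq_node) : omega1 := sval (cid (svalP f)).

Definition entry (f : seq_node) (a : omega1) : nat := odflt 0 (sval f a).

Lemma lenE (f : seq_node) a : sval f a <> None <-> (a < len f)%O.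
Proof.
rewrite /len; case: (cid _) => b /= fb.
by rewrite -[_ <> _]/(pdom (sval f) a) fb /omega1_seg /= omega1_ltE.
Qed.

Lemma entryE (f : seq_node) a : (a < len f)%O -> sval f a = Some (entry f a).
Proof. by move/lenE; rewrite /entry; case: (sval f a). Qed.

Lemma sval_geq_len (f : seq_node) a : (len f <= a)%O -> sval f a = None.
Proof.
rewrite leNgt => /negP nfa; apply: contrapT => fa.
by apply: nfa; apply/lenE.
Qed.

Lemma seq_node_eq (f g : seq_node) : len f = len g ->
  (forall a, (a < len f)%O -> entry f a = entry g a) -> f = g.
Proof.
move=> fg fgE; have {fgE} : sval f = sval g.
  apply/funext => a; have [af|fa] := ltP a (len f).
    by rewrite !entryE -?fg // fgE.
  by rewrite !sval_geq_len // -fg.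
case: f g {fg} => [f pf] [g pg] /= fg; rewrite -fg in pg *.
by congr exist; exact: Prop_irrelevance.
Qed.

Fact mknode_subproof (b : omega1) (h : omega1 -> nat) :
  exists c, pdom (fun a => if (a < b)%O then Some (h a) else None) = omega1_seg c.
Proof.
exists b; apply/seteqP; split=> a; rewrite /pdom /omega1_seg /= omega1_ltE.
  by case: ifP.
by move=> ->.
Qed.

Definition mknode b h : seq_node := exist _ _ (mknode_subproof b h).

Lemma len_mknode b h : len (mknode b h) = b.
Proof.
have E a : (a < len (mknode b h))%O <-> (a < b)%O.
  by rewrite -lenE /=; case: ifP.
by case: (ltgtP (len (mknode b h)) b) => // /E; rewrite ltxx.
Qed.

Lemma entry_mknode b h a : (a < b)%O -> entry (mknode b h) a = h a.
Proof. by rewrite /entry /= => ->. Qed.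

Lemma seq_ltP (f g : seq_node) : seq_lt f g <->
  (len f < len g)%O /\ forall a, (a < len f)%O -> entry f a = entry g a.
Proof.
split=> [[fg nfg]|[lfg fg]].
  have fgv a : (a < len f)%O -> entry f a = entry g a.
    by move=> /entryE/fg ga; rewrite [RHS]/entry ga.
  split=> //; rewrite ltNge le_eqVlt; apply/negP => /orP[/eqP gf|gf].
    by apply: nfg; apply: seq_node_eq.
  have : sval g (len g) <> None by rewrite (fg _ _ (entryE gf)).
  by rewrite sval_geq_len.
split=> [a n fa|fg']; last by rewrite fg' ltxx in lfg.
have af : (a < len f)%O by apply/lenE; rewrite fa.
by rewrite entryE ?(lt_trans af) // -fg // /entry fa.
Qed.

Lemma seq_lt_common_eq (f g y : seq_node) : seq_lt f y -> seq_lt g y ->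
  len f = len g -> f = g.
Proof.
move=> /seq_ltP[_ fy] /seq_ltP[_ gy] fg; apply: seq_node_eq => // a af.
by rewrite fy // gy // -fg.
Qed.

(** Composed with the restrictions of [t], the given isomorphism maps one initial segment of
    [omega1] onto another and preserves order. By well-founded induction it is the identity, so the
    two segments agree. *)
Lemma level_len (t : seq_tree) b : level seq_tree b t -> len t = b.
Proof.
move=> [f [ffun finj fsurj] fmono].
pose r a := mknode a (entry t).
have rt a : (a < len t)%O -> seq_lt (r a) t.
  move=> al; apply/seq_ltP; rewrite len_mknode; split=> // x xa.
  by rewrite entry_mknode.
have rlen (x : seq_node) : seq_lt x t -> r (len x) = x.
  by move=> /seq_ltP[_ xt]; apply: seq_node_eq => [|a];
     rewrite len_mknode // => ax; rewrite entry_mknode // xt.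
have flt a : (a < len t)%O -> (f (r a) < b)%O.
  by move=> /rt/ffun /omega1_ltE.
have rmono x y : (y < len t)%O -> (x < y)%O -> (f (r x) < f (r y))%O.
  move=> yt xy; apply/omega1_ltE; apply/(fmono _ _ (rt _ (lt_trans xy yt)) (rt _ yt)).
  by apply/seq_ltP; rewrite !len_mknode; split=> // a ax; rewrite !entry_mknode // (lt_trans ax).
have rsurj x : (x < b)%O -> exists2 a, (a < len t)%O & f (r a) = x.
  move=> /omega1_ltE /fsurj[s st <-]; exists (len s); last by rewrite rlen.
  by have /seq_ltP[] := st.
have fid a : (a < len t)%O -> f (r a) = a.
  elim/(well_founded_ind omega1_wf): a => a IH al.
  case: (ltgtP (f (r a)) a) => // [ga|ag].
    have := IH _ (iffRL (omega1_ltE _ _) ga) (lt_trans ga al).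
    move=> gga; have := rmono _ _ al ga; by rewrite gga ltxx.
  have [c cl gc] := rsurj a (lt_trans ag (flt _ al)).
  have ca : (c < a)%O.
    rewrite ltNge le_eqVlt; apply/negP => /orP[/eqP ac|ac].
      by move: ag; rewrite ac gc -ac ltxx.
    by have := rmono _ _ cl ac; rewrite gc => /(lt_trans ag); rewrite ltxx.
  have := IH _ (iffRL (omega1_ltE _ _) ca) cl.
  by move=> cE; rewrite -gc cE ltxx in ca.
case: (ltgtP (len t) b) => // [lb|bl].
  have [c cl gc] := rsurj _ lb.
  by rewrite fid // in gc; rewrite gc ltxx in cl.
by have := flt _ bl; rewrite fid // ltxx.
Qed.

(** Dependent choice with a relation that varies with the stage; the constructions of length omega
    below that serve the colours one by one use it. *)
Lemma dependent_sequence (S : Type) (P : S -> Prop) (R : nat -> S -> S -> Prop) (x0 : S) :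
  P x0 -> (forall n x, P x -> exists y, P y /\ R n x y) ->
  exists f : nat -> S, f 0 = x0 /\ forall n, P (f n) /\ R n (f n) (f n.+1).
Proof.
move=> Px0 step.
have [next nextP] : {next : nat * S -> S & forall q, P q.2 ->
    P (next q) /\ R q.1 q.2 (next q)}.
  apply: (@choice (nat * S) S (fun q y => P q.2 -> P y /\ R q.1 q.2 y)) => -[n x].
  have [/(step n)[y]|nPx] := pselect (P x); last by exists x0.
  by exists y.
pose f := fix f n := if n is n'.+1 then next (n', f n') else x0.
have Pf n : P (f n) by elim: n => // n /(nextP (n, f n))[].
by exists f; split=> // n; split=> //; have [] := nextP (n, f n) (Pf n).
Qed.

(** * Pointers and pure extensions *)

Fact code_subproof (a : omega1) : exists e : omega1 -> nat, {in omega1_seg a &, injective e}.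
Proof. exact/countable_injP/omega1_lt_countable. Qed.

(** An entry is a single natural number but must be able to name any earlier position; a fixed
    injection of the predecessors of [a] into [nat] supplies the names. *)
Definition code (a : omega1) : omega1 -> nat := sval (cid (code_subproof a)).

Lemma code_inj a x y : (x < a)%O -> (y < a)%O -> code a x = code a y -> x = y.
Proof.
move=> xa ya; apply: (svalP (cid (code_subproof a))); rewrite inE;
  exact/omega1_ltE.
Qed.

(* The entry at [a] is read as a finite set of pairs (label, [code a]-name of a
   position below [a]). *)
Definition points (w : seq_node) (a : omega1) (i : nat) (g : omega1) : Prop :=
  (g < a)%O /\ (i, code a g) \in odflt [::] (unpickle (entry w a) : option (seq (nat * nat))).

Lemma eq_points w w' a i g : entry w a = entry w' a -> points w a i g -> points w' a i g.
Proof. by rewrite /points => ->. Qed.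

Definition mark (a : omega1) (l : seq (nat * omega1)) : nat :=
  pickle [seq (p.1, code a p.2) | p <- l].

Fact osucc_subproof (a : omega1) :
  exists b, (a < b)%O /\ forall x, (x < b)%O -> (x <= a)%O.
Proof. by have [b] := omega1_succ a; exists b. Qed.

Definition osucc a := sval (cid (osucc_subproof a)).

Lemma ltoS a x : (x < osucc a)%O = (x <= a)%O.
Proof.
rewrite /osucc; case: cid => b /= [ab bP].
by apply/idP/idP => [/bP//|/le_lt_trans]; apply.
Qed.

Definition snoc (v : seq_node) (l : seq (nat * omega1)) : seq_node :=
  mknode (osucc (len v)) (fun a => if (a < len v)%O then entry v a else mark a l).

Lemma len_snoc v l : len (snoc v l) = osucc (len v).
Proof. exact: len_mknode. Qed.

Lemma entry_snoc v l a : (a < len v)%O -> entry (snoc v l) a = entry v a.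
Proof. by move=> av; rewrite entry_mknode ?av // ltoS ltW. Qed.

Lemma points_snoc v l i g : (forall p, p \in l -> (p.2 < len v)%O) ->
  points (snoc v l) (len v) i g <-> (i, g) \in l.
Proof.
move=> lv; rewrite /points entry_mknode ?ltoS // ltxx /mark pickleK /=.
split=> [[gv /mapP[[j h] jl /= [-> gh]]]|il].
  by rewrite (code_inj gv _ gh) //; apply: (lv _ jl).
by split; [apply: (lv _ il)|apply/mapP; exists (i, g)].
Qed.

(* Labels 0 and 1 point to ladder elements and to the record of the tuple.  Larger
   labels spell out the tuple itself: they must be exempt, because the record is
   written after the nodes separating the tuple entries. *)
Definition pure_ext (v w : seq_node) : Prop :=
  [/\ (len v <= len w)%O,
      forall a, (a < len v)%O -> entry v a = entry w a
    & forall a i g, i < 2 -> (len v <= a)%O -> (a < len w)%O -> points w a i g ->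
        (len v <= g)%O].

Lemma pure_ext_refl v : pure_ext v v.
Proof. by split=> // a i g _ va /(le_lt_trans va); rewrite ltxx. Qed.

Lemma pure_ext_trans w v z : pure_ext v w -> pure_ext w z -> pure_ext v z.
Proof.
move=> [vw vwE vwP] [wz wzE wzP]; split=> [|a av|a i g i2 va az ag].
- exact: le_trans wz.
- by rewrite vwE // wzE // (lt_le_trans av).
- have [aw|wa] := ltP a (len w).
    by apply: (vwP a i g) => //; apply: eq_points ag; rewrite wzE.
  exact: le_trans vw (wzP _ _ _ i2 wa az ag).
Qed.

Lemma pure_ext_len v w : pure_ext v w -> (len v <= len w)%O.
Proof. by case. Qed.

Lemma pure_ext_snoc w v l : pure_ext w v ->
  (forall p, p \in l -> (p.2 < len v)%O) ->
  (forall p, p \in l -> p.1 < 2 -> (len w <= p.2)%O) -> pure_ext w (snoc v l).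
Proof.
move=> [wv wvE wvP] lv lw; split=> [|a aw|a i g i2 wa].
- by rewrite len_snoc; apply: le_trans wv _; rewrite ltW // ltoS.
- by rewrite entry_snoc ?wvE // (lt_le_trans aw).
- rewrite len_snoc ltoS le_eqVlt => /orP[/eqP ->|av pg].
    by move/(points_snoc _ _ lv)/lw => /(_ i2).
  by apply: (wvP a i g i2 wa av); apply: eq_points pg; rewrite entry_snoc.
Qed.

Lemma chain_pure_ext (v : nat -> seq_node) : (forall i, pure_ext (v i) (v i.+1)) ->
  forall i j, i <= j -> pure_ext (v i) (v j).
Proof.
move=> vS i j /subnKC <-; elim: (j - i) => [|n IH]; first by rewrite addn0; exact: pure_ext_refl.
by rewrite addnS; apply: pure_ext_trans IH _.
Qed.

Lemma seq_node_sup (v : nat -> seq_node) :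
  (forall i, (len (v i) <= len (v i.+1))%O /\
     forall a, (a < len (v i))%O -> entry (v i) a = entry (v i.+1) a) ->
  exists w, [/\ forall i, (len (v i) <= len w)%O,
    forall i a, (a < len (v i))%O -> entry (v i) a = entry w a
    & forall a, (a < len w)%O -> exists i, (a < len (v i))%O].
Proof.
move=> vS; have [b vb bv] := omega1_sup (fun i => len (v i)).
have vle i j : i <= j -> (len (v i) <= len (v j))%O /\
     forall a, (a < len (v i))%O -> entry (v i) a = entry (v j) a.
  move=> /subnKC <-; elim: (j - i) => [|n [le1 eq1]]; first by rewrite addn0.
  rewrite addnS; have [le2 eq2] := vS (i + n); split=> [|a ai]; first exact: le_trans le2.
  by rewrite eq1 // eq2 // (lt_le_trans ai).
have vE i j a : (a < len (v i))%O -> (a < len (v j))%O -> entry (v i) a = entry (v j) a.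
  by case/orP: (leq_total i j) => /vle[_ e] ai aj; rewrite e.
(* [xget] picks some stage that already contains [a]; by [vE] the choice is immaterial. *)
exists (mknode b (fun a => entry (v (xget 0 [set i | (a < len (v i))%O])) a)).
split=> [i|i a ai|a]; rewrite ?len_mknode; [exact: vb| |exact: bv].
rewrite entry_mknode ?(lt_le_trans ai) //; apply: vE => //.
by apply: (@xgetPex _ 0 [set i | (a < len (v i))%O]); exists i.
Qed.

(** A pointer of the union already occurs in some stage [v k], and its position past [len (v i)]
    forces [i <= k]; so purity of the stages suffices. *)
Lemma pure_ext_sup (v : nat -> seq_node) : (forall i, pure_ext (v i) (v i.+1)) ->
  exists w, forall i, pure_ext (v i) w.
Proof.
move=> vS; have [|w [vw vwE wv]] := @seq_node_sup v; first by move=> i; case: (vS i).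
exists w => i; split=> [||a j g j2 va aw ag]; [exact: vw|exact: vwE|].
have [k ak] := wv a aw.
have ik : i <= k.
  case: (leqP i k) => // /ltnW /(chain_pure_ext vS)/pure_ext_len ki.
  by have := le_lt_trans (le_trans ki va) ak; rewrite ltxx.
have [_ _ ikP] := chain_pure_ext vS ik.
by apply: (ikP a j g j2 va ak); apply: eq_points ag; rewrite (vwE k).
Qed.

(** * The ladder graph *)

Definition ozero : omega1 := sval (cid omega1_zero).

(** Since only cofinally repeated pointers count, a node built as a union is not disturbed by stray
    pointers inside its building blocks. *)
Definition limit_target (y : seq_node) (i : nat) (g : omega1) : Prop :=
  forall d, (d < len y)%O -> exists a, [/\ (d <= a)%O, (a < len y)%O & points y a i g].

Section LadderGraph.

Variables k m : nat.

Definition codes_tuple (y : seq_node) (s : seq omega1) : Prop :=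
  [/\ size s = m, sorted <%O s
    & exists r, [/\ (r < len y)%O, forall g, limit_target y 1 g <-> g = r
        & forall i g, i < m -> (points y r i.+2 g <-> g = nth ozero s i)]].

Definition interleaved (s s' : seq omega1) : Prop :=
  forall j, j + k < m -> (nth ozero s (j + k) < nth ozero s' j)%O /\
    (j + k.+1 < m -> (nth ozero s' j < nth ozero s (j + k.+1))%O).

(** [edge_finite] serves the Hajnal-Mate finiteness condition, [edge_interleaved] the absence of
    short odd cycles; [edge_above] and [edge_isolated] keep apart the paths descending from
    different ladder elements. *)
Record ladder_edge (y u : seq_node) (s s' : seq omega1) : Prop := LadderEdge {
  edge_lt : seq_lt u y;
  edge_target : limit_target y 0 (len u);
  edge_finite : forall d, (d < len y)%O ->
    finite_set [set g | (g < d)%O /\ limit_target y 0 g];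
  edge_top : codes_tuple y s;
  edge_bot : codes_tuple u s';
  edge_interleaved : interleaved s s';
  edge_above : (nth ozero s m.-1 < len u)%O;
  edge_isolated : forall g, limit_target y 0 g -> (g < len u)%O ->
    (g < nth ozero s' m.-1)%O
}.

Definition ladder_child y u := exists s s', ladder_edge y u s s'.

Lemma codes_tuple_uniq y s s' : codes_tuple y s -> codes_tuple y s' -> s = s'.
Proof.
move=> [sm _ [r [_ rE sE]]] [s'm _ [r' [_ r'E s'E]]].
have rr' : r' = r by apply/rE/r'E.
apply: (@eq_from_nth _ ozero); rewrite sm // => i im.
by apply/(s'E _ _ im); rewrite rr'; apply/(sE _ _ im).
Qed.

Lemma codes_tuple_mono y s i j : codes_tuple y s -> i <= j -> j < m ->
  (nth ozero s i <= nth ozero s j)%O.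
Proof.
move=> [sm ss _] ij jm; rewrite (lt_sorted_leq_nth _ ss) // inE sm //.
exact: leq_ltn_trans jm.
Qed.

Lemma down_lt y u : ladder_child y u -> seq_lt u y.
Proof. by case=> s [s' []]. Qed.

Definition ladder_adj u v := ladder_child u v \/ ladder_child v u.

Lemma ladder_adj_sym u v : ladder_adj u v -> ladder_adj v u.
Proof. by case; [right|left]. Qed.

Lemma ladder_adj_irr u : ~ ladder_adj u u.
Proof. by case=> /down_lt/seq_lt_irr. Qed.

Definition ladder_graph : graph seq_tree := Graph ladder_adj_sym ladder_adj_irr.

Lemma ladder_adj_down u v : ladder_adj u v -> seq_lt v u -> ladder_child u v.
Proof. by case=> // /down_lt/seq_lt_trans tr /tr/seq_lt_irr. Qed.

(** * Interleaved tuples and odd closed walks *)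

Lemma edge_step y u s s' : ladder_edge y u s s' ->
  [/\ forall i, k <= i -> i < m -> (nth ozero s i < nth ozero s' (i - k))%O,
      forall i, k < i -> i < m -> (nth ozero s' (i - k.+1) < nth ozero s i)%O,
      forall i, i + k < m -> (nth ozero s (i + k) < nth ozero s' i)%O
    & forall i, i + k.+1 < m -> (nth ozero s' i < nth ozero s (i + k.+1))%O].
Proof.
move=> e; have lo i : i + k < m -> (nth ozero s (i + k) < nth ozero s' i)%O.
  by case/(edge_interleaved e).
have hi i : i + k.+1 < m -> (nth ozero s' i < nth ozero s (i + k.+1))%O.
  by move=> im; have [|_] := edge_interleaved e (j := i); [lia|apply].
by split=> // i ki im; [have := lo (i - k)|have := hi (i - k.+1)]; rewrite subnK //; apply.
Qed.

(* The counting behind Specker graphs: moving the index by [- p] or [+ q] according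
   to the direction of each step makes the entries strictly [R]-monotone along the
   walk.  On a closed walk this bounds the net displacement of the index. *)
Lemma track_index (R : rel omega1) (f : nat -> nat -> omega1) (b : nat -> bool) p q L :
  transitive R -> p <= k.+1 -> q <= k.+1 -> 0 < L -> 2 * (k.+1 * L) < m ->
  (forall j i, j < L -> b j -> p <= i -> i < m -> R (f j i) (f j.+1 (i - p))) ->
  (forall j i, j < L -> ~~ b j -> i + q < m -> R (f j i) (f j.+1 (i + q))) ->
  exists i, [/\ i + p * \sum_(j < L) b j = k.+1 * L + q * \sum_(j < L) ~~ b j,
    i < m & R (f 0 (k.+1 * L)) (f L i)].
Proof.
move=> Rtr pk qk L0 Lm fb fnb.
(* Each step moves the index by at most [k.+1]. Started at [k.+1 * L], it therefore stays between 0
   and twice that value, hence below [m]; the induction carries these bounds. *)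
suff /(_ L L0 (leqnn L)) [i [iE _ _ im Ri]] : forall j, 0 < j -> j <= L -> exists i,
    [/\ i + p * \sum_(j < j) b j = k.+1 * L + q * \sum_(j < j) ~~ b j,
      k.+1 * L <= i + k.+1 * j, i <= k.+1 * L + k.+1 * j, i < m
      & R (f 0 (k.+1 * L)) (f j i)].
  by exists i.
have kL j : j < L -> k.+1 * j + k.+1 <= k.+1 * L.
  by move=> jL; rewrite -mulnSr leq_mul2l jL orbT.
have step j i : j < L -> k.+1 * L <= i + k.+1 * j -> i <= k.+1 * L + k.+1 * j ->
    i + p * \sum_(j < j) b j = k.+1 * L + q * \sum_(j < j) ~~ b j -> i < m ->
    exists i', [/\ i' + p * \sum_(j < j.+1) b j = k.+1 * L + q * \sum_(j < j.+1) ~~ b j,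
      k.+1 * L <= i' + k.+1 * j.+1, i' <= k.+1 * L + k.+1 * j.+1, i' < m
      & R (f j i) (f j.+1 i')].
  move=> jL lo hi iE im; have kj := kL _ jL.
  rewrite !big_ord_recr /= !mulnDr mulnSr.
  move: iE; move: (p * _) (q * _) => P Q iE; have pi : p <= i by lia.
  case bj: (b j) => /=; rewrite ?muln1 ?muln0.
    exists (i - p); split; try lia.
    by apply: fb => //; lia.
  exists (i + q); split; try lia.
  by apply: fnb => //; [rewrite bj|lia].
elim=> [//|j IH] _ jL; have [j0|j0] := posnP j.
  subst j; apply: step => //; rewrite ?big_ord0; lia.
have [i [iE lo hi im Ri]] := IH j0 (ltnW jL).
have [i' [i'E lo' hi' i'm Ri']] := step j i jL lo hi iE im.
by exists i'; split=> //; apply: Rtr Ri'.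
Qed.

(** Let D and U count the descending and ascending steps. Tracking with increasing entries gives kD
    < (k+1)U, with decreasing entries kU < (k+1)D. For odd L the two counts differ, and then the
    smaller one exceeds k, so that L is at least 2k+3. *)
Lemma no_short_odd_closed_walk (y : nat -> seq_node) L :
  (forall j, ladder_adj (y j) (y j.+1)) -> y L = y 0 ->
  odd L -> L <= 2 * k + 1 -> 2 * (k.+1 * L) < m -> False.
Proof.
move=> adjy yL oddL Lk Lm.
have [t tP] : {t : nat -> seq omega1 & forall j, codes_tuple (y j) (t j)}.
  apply: (@choice _ _ (fun j s => codes_tuple (y j) s)) => j.
  case: (adjy j) => [] [s [s' e]]; first by exists s; exact: edge_top e.
  by exists s'; exact: edge_bot e.
have tL : t L = t 0 by apply: (@codes_tuple_uniq (y 0)); [rewrite -yL|]; exact: tP.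
pose b j := `[< ladder_child (y j) (y j.+1) >].
have eP j : b j -> ladder_edge (y j) (y j.+1) (t j) (t j.+1).
  move=> /asboolP[s [s' e]]; rewrite (codes_tuple_uniq (tP j) (edge_top e)).
  by rewrite (codes_tuple_uniq (tP j.+1) (edge_bot e)).
have eP' j : ~~ b j -> ladder_edge (y j.+1) (y j) (t j.+1) (t j).
  move=> /asboolPn nd; case: (adjy j) => // -[s [s' e]].
  rewrite (codes_tuple_uniq (tP j) (edge_bot e)).
  by rewrite (codes_tuple_uniq (tP j.+1) (edge_top e)).
have L0 : 0 < L by exact: odd_gt0.
have DU : \sum_(j < L) b j + \sum_(j < L) ~~ b j = L.
  rewrite -big_split /= -[RHS]card_ord -sum1_card; apply: eq_bigr => i _.
  by case: (b i).
pose f j i := nth ozero (t j) i.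
(* Shifting down by [k] on descents and up by [k.+1] on ascents makes the entries increase. *)
have [i [iE im iR]] : exists i, [/\ i + k * \sum_(j < L) b j =
    k.+1 * L + k.+1 * \sum_(j < L) ~~ b j, i < m & (f 0 (k.+1 * L) < f L i)%O].
  apply: (@track_index <%O) => //; first exact: lt_trans.
  - by move=> j i _ /eP/edge_step[e _ _ _]; apply: e.
  - by move=> j i _ /eP'/edge_step[_ _ _ e]; apply: e.
(* Exchanging the two shifts makes the entries decrease. *)
have [i' [i'E i'm i'R]] : exists i, [/\ i + k.+1 * \sum_(j < L) b j =
    k.+1 * L + k * \sum_(j < L) ~~ b j, i < m & (f L i < f 0 (k.+1 * L))%O].
  apply: (@track_index >%O) => //; first by move=> x y' z xy yz; exact: lt_trans xy.
  - by move=> j i' _ /eP/edge_step[_ e _ _]; apply: e.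
  - by move=> j i' _ /eP'/edge_step[_ _ e _]; apply: e.
rewrite /f tL in iR i'R.
have iN : k.+1 * L < i.
  by rewrite ltnNge; apply/negP => /(codes_tuple_mono (tP 0))/(_ ltac:(lia)); rewrite leNgt iR.
have i'N : i' < k.+1 * L.
  by rewrite ltnNge; apply/negP => /(codes_tuple_mono (tP 0))/(_ i'm); rewrite leNgt i'R.
move: DU iE i'E oddL Lk iN i'N.
move: (\sum_(j < L) b j) (\sum_(j < L) ~~ b j) => D U DU iE i'E oddL Lk iN i'N.
have [DU'|UD] := ltnP U D.
  have : k * U.+1 <= k * D by rewrite leq_mul2l DU' orbT.
  by rewrite mulnSr; lia.
have UD' : D < U by rewrite ltn_neqAle UD andbT; apply/eqP => E; lia.
have : k * D.+1 <= k * U by rewrite leq_mul2l UD' orbT.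
by rewrite mulnSr; lia.
Qed.

(** * Descending paths *)

Lemma edge_bot_last y u s s' : 0 < m -> k < m -> ladder_edge y u s s' ->
  (nth ozero s m.-1 < nth ozero s' m.-1)%O.
Proof.
move=> m0 km e; have [_ _ lo _] := edge_step e.
have := lo (m.-1 - k); rewrite subnK; last by lia.
move=> /(_ ltac:(lia)) /lt_le_trans; apply.
by apply: (codes_tuple_mono (edge_bot e)); lia.
Qed.

(** By [edge_bot_last] the last tuple entries grow along a descending path, and by [edge_above] each
    node is longer than the last entry of its predecessor. So the path never drops below the last
    entry of the tuple of [y i]. *)
Lemma descending_above (y : nat -> seq_node) s s' z i j :
  k < m -> ladder_edge z (y i) s s' -> i < j ->
  (forall l, i <= l < j -> ladder_child (y l) (y l.+1)) ->
  (nth ozero s' m.-1 < len (y j))%O.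
Proof.
move=> km e ij yd.
suff [s1 [s2 [e1 s12]]] : exists s1 s2, ladder_edge (y j.-1) (y j) s1 s2 /\
    (nth ozero s' m.-1 <= nth ozero s1 m.-1)%O.
  exact: le_lt_trans s12 (edge_above e1).
elim: j ij yd => // j IH; rewrite ltnS leq_eqVlt => /orP[/eqP <-|ij] yd /=.
  have [|s1 [s2 e1]] := yd i; first by lia.
  by exists s1, s2; split=> //; rewrite (codes_tuple_uniq (edge_top e1) (edge_bot e)).
have [|s1 [s2 [e1 le1]]] := IH ij; first by move=> l lj; apply: yd; lia.
have [|s3 [s4 e3]] := yd j; first by lia.
exists s3, s4; split=> //; rewrite (codes_tuple_uniq (edge_top e3) (edge_bot e1)).
by apply: le_trans le1 (ltW (edge_bot_last _ km e1)); lia.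
Qed.

End LadderGraph.

(** * Cycles in the ladder graph *)

Lemma descending_len (y : nat -> seq_node) r : 0 < r ->
  (forall j, j < r -> seq_lt (y j.+1) (y j)) -> (len (y r) <= len (y 1))%O.
Proof.
elim: r => // -[//|r] IH _ yd.
have /seq_ltP[/ltW lt1 _] := yd r.+1 (ltnSn _).
by apply: le_trans lt1 (IH _ _) => // j jr; apply: yd; exact: ltnW.
Qed.

(** Indexing a cycle by all natural numbers modulo [n] turns it into a closed walk whose closing
    edge needs no separate treatment. *)
Definition cyc (S : Type) n (x : 'I_n -> S) (n0 : 0 < n) (j : nat) : S :=
  x (Ordinal (ltn_pmod j n0)).

Lemma cycS (S : Type) n (x : 'I_n -> S) n0 j :
  cyc x n0 j.+1 = x (ordS (Ordinal (ltn_pmod j n0))).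
Proof.
apply: (congr1 x); apply: ord_inj => /=.
by rewrite -addn1 -[(_ %% _).+1]addn1 modnDml.
Qed.

Lemma cyc_mod (S : Type) n (x : 'I_n -> S) n0 : cyc x n0 n = cyc x n0 0.
Proof. by apply: (congr1 x); apply: ord_inj; rewrite /= modnn mod0n. Qed.

Section LadderGraphProperties.

Variables k m : nat.
Hypothesis km : k < m.

(** If [y 1] were shorter than [y' 1], then, being a ladder element of the common top, it would lie
    below the last tuple entry of [y' 1] by [edge_isolated]. The path [y'] would stay above
    [len (y 1)], while [y] ends at or below it, so they could not end together. *)
Lemma descending_paths_meet (y y' : nat -> seq_node) r r' :
  0 < r -> 0 < r' -> y 0 = y' 0 -> y r = y' r' ->
  (forall j, j < r -> ladder_child k m (y j) (y j.+1)) ->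
  (forall j, j < r' -> ladder_child k m (y' j) (y' j.+1)) ->
  (len (y' 1) <= len (y 1))%O.
Proof.
move=> r0 r'0 yy'0 yy'r yd y'd; rewrite leNgt; apply/negP => l11.
have [s [s1 e]] := yd 0 r0; have [s' [s1' e']] := y'd 0 r'0.
have := edge_target e; rewrite yy'0 => /(edge_isolated e')/(_ l11) l1.
have : (len (y' r') <= len (y 1))%O.
  by rewrite -yy'r; apply: descending_len => // j jr; apply: down_lt (yd _ jr).
rewrite leNgt => /negP; apply; move: r'0; rewrite leq_eqVlt => /orP[/eqP <- //|r'1].
apply: lt_trans l1 _; apply: (descending_above km e') => // l /andP[_ lr'].
exact: y'd.
Qed.

(** The two sides of a special cycle descend from [x_0] to the same node. Applying
    [descending_paths_meet] both ways makes their first steps equal, so [x_1] and [x_(n-1)]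
    coincide, against injectivity. *)
Lemma ladder_graph_special_cycle_free : special_cycle_free (ladder_graph k m).
Proof.
move=> [n [x [[n3 xinj xadj] [r rn [xd xu]]]]].
have n0 : 0 < n by lia.
pose y := cyc x n0.
have yadj j : ladder_adj k m (y j) (y j.+1) by rewrite /y cycS; exact: xadj.
have yd j : j < r -> ladder_child k m (y j) (y j.+1).
  move=> jr; apply: ladder_adj_down (yadj j) _.
  by rewrite /y cycS; apply: xd; rewrite /= modn_small // (ltn_trans jr).
have yu j : r <= j -> j < n -> ladder_child k m (y j.+1) (y j).
  move=> rj jn; apply: ladder_adj_down (ladder_adj_sym (yadj j)) _.
  by rewrite /y cycS; apply: xu; rewrite /= modn_small.
pose y' j := y (n - j).
have y'd j : j < n - r -> ladder_child k m (y' j) (y' j.+1).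
  move=> jr; rewrite /y'; have -> : n - j = (n - j.+1).+1 by lia.
  by apply: yu; lia.
have yn : y n = y 0 by exact: cyc_mod.
have y'0 : y' 0 = y 0 by rewrite /y' subn0.
(* For [r = 0] the cycle read backwards would descend from [y 0] to itself. *)
have [r0|r0] := posnP r.
  have : (len (y' n) <= len (y' 1))%O.
    by apply: descending_len => // j jn; apply: down_lt; apply: y'd; rewrite r0 subn0.
  have /down_lt/seq_ltP[y10 _] : ladder_child k m (y' 0) (y' 1) by apply: y'd; lia.
  by rewrite leNgt /y' subnn; move: y10; rewrite y'0 => ->.
have y'r : y' (n - r) = y r by rewrite /y'; congr y; lia.
have r'0 : 0 < n - r by lia.
have le1 := descending_paths_meet r0 r'0 (esym y'0) (esym y'r) yd y'd.
have le2 := descending_paths_meet r'0 r0 y'0 y'r y'd yd.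
have lt1 := down_lt (yd _ r0); have lt2 := down_lt (y'd _ r'0); rewrite y'0 in lt2.
have : y 1 = y' 1 by apply: (seq_lt_common_eq lt1 lt2); apply/eqP; rewrite eq_le le1 le2.
by move=> /xinj [] /=; rewrite !modn_small //; lia.
Qed.

Lemma ladder_graph_no_odd_cycle n (x : 'I_n -> seq_node) :
  is_cycle (ladder_graph k m) x -> odd n -> n <= 2 * k + 1 ->
  2 * (k.+1 * n) < m -> False.
Proof.
move=> [n3 _ xadj]; have n0 : 0 < n by apply: leq_trans n3.
apply: (@no_short_odd_closed_walk _ _ (cyc x n0)); last exact: cyc_mod.
by move=> j; rewrite cycS; exact: xadj.
Qed.

(** A neighbour shorter than [a] lies below [t], so its length is a ladder position of [t] below
    [a], and this length determines it. There are finitely many by [edge_finite]. *)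
Lemma ladder_graph_finite (a b : omega1) (t : seq_tree) : omega1_lt a b ->
  level seq_tree b t ->
  finite_set [set s | levels_below seq_tree a s /\ adj (ladder_graph k m) s t].
Proof.
move=> /omega1_ltE ab /level_len tb.
set X := [set _ | _].
have Xd u : X u -> (len u < a)%O /\ ladder_child k m t u.
  move=> [[c /omega1_ltE ca /level_len uc] ut]; rewrite uc; split=> //.
  case: ut => // /down_lt/seq_ltP[tu _].
  by move: (lt_trans ca ab); rewrite -uc -tb => /(lt_trans tu); rewrite ltxx.
have [[u0 /Xd[_ [s [s' e]]]]|X0] := pselect (X !=set0); last first.
  suff -> : X = set0 by exact: finite_set0.
  by apply/seteqP; split=> // u Xu; apply: X0; exists u.
have := edge_finite e (d := a); rewrite tb => /(_ ab) fin.
apply: (sub_finite_set _ (finite_image (fun g => mknode g (entry t)) fin)).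
move=> u /Xd[ua tu].
have [s1 [s2 e1]] := tu; exists (len u); first by split=> //; exact: edge_target e1.
have /seq_ltP[_ vE] := down_lt tu.
by apply: seq_node_eq => [|g]; rewrite len_mknode // => gu; rewrite entry_mknode // vE.
Qed.

End LadderGraphProperties.

(** * Minimality of omega_1 among uncountable cardinals *)

Local Open Scope card_scope.

(** By recursion on [omega1], choose a value distinct from the countably many earlier ones. *)
Lemma omega1_card_le (N : Type) : ~ countable [set: N] -> [set: omega1] #<= [set: N].
Proof.
move=> Nunc.
have [n0 _] : [set: N] !=set0.
  by apply/set0P/eqP => N0; apply: Nunc; rewrite N0; exact: countable0.
have fresh (a : omega1) (h : forall b, omega1_lt b a -> N) :
    exists n, forall b ba, h b ba <> n.
  apply: contrapT => nf; apply: (Nunc).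
  pose h' b := if pselect (omega1_lt b a) is left ba then h b ba else n0.
  apply: (@sub_countable _ _ _ (h' @` omega1_seg a)); last first.
    by apply: sub_countable (omega1_lt_countable a); exact: card_image_le.
  apply: subset_card_le => n _; apply: contrapT => nh; apply: nf; exists n => b ba hn.
  apply: nh; exists b => //; rewrite /h'; case: pselect => // ba'.
  by rewrite (Prop_irrelevance ba' ba).
pose g := Fix omega1_wf (fun=> N) (fun a h => sval (cid (fresh a h))).
have gE a b : omega1_lt b a -> g b <> g a.
  move=> ba; rewrite [g a]/g Fix_eq; last first.
    move=> x f1 f2 f12; congr (sval (cid (fresh x _))).
    by apply: functional_extensionality_dep => z; apply: functional_extensionality_dep.
  by move=> E; apply: (svalP (cid (fresh a (fun y _ => g y))) b ba).
have : {in [set: omega1] &, injective g} => [a b _ _ gab|/inj_card_eq]; last first.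
  rewrite card_eqPle => -[_ /card_le_trans]; apply; exact: card_leT.
have [ab|//|ba] : [\/ omega1_lt a b, a = b | omega1_lt b a].
  by case: omega1_well_ordered => _ _ tot _; apply: tot.
- by have := gE _ _ ab; rewrite gab.
- by have := gE _ _ ba; rewrite gab.
Qed.

(** * Countable colourings of the ladder graph *)

Section Colouring.

Variables (k m : nat) (c : seq_node -> nat).

(* [s] is the part of the tuple chosen so far and [r] the number of missing entries. *)
Fixpoint possible (r : nat) (s : seq omega1) (v : seq_node) (a : nat) : Prop :=
  if r is r'.+1 then
    exists w h, [/\ pure_ext v w, (len v <= h)%O, (h < len w)%O
      & forall w', pure_ext w w' -> possible r' (rcons s h) w' a]
  else exists u, [/\ pure_ext v u, codes_tuple m u s & c u = a].

Definition good r s v a := forall w, pure_ext v w -> possible r s w a.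

Lemma possible_anti r s v v' a : pure_ext v v' -> possible r s v' a -> possible r s v a.
Proof.
move=> vv'; case: r => [|r] /= [u].
  by case=> v'u us ua; exists u; split=> //; apply: pure_ext_trans v'u.
case=> h [v'u v'h hu rP]; exists u, h; split=> //; first exact: pure_ext_trans v'u.
exact: le_trans (pure_ext_len vv') v'h.
Qed.

Lemma good_mono r s v v' a : pure_ext v v' -> good r s v a -> good r s v' a.
Proof. by move=> vv' gv w v'w; apply: gv; apply: pure_ext_trans v'w. Qed.

Lemma good_possible r s v a : good r s v a -> possible r s v a.
Proof. by apply; exact: pure_ext_refl. Qed.

(** Treat the colours in turn: if [a] is not good, pass to a pure extension where it is no longer
    possible. Impossibility and goodness both persist to the union. *)
Lemma deciding_ext r s v :
  exists w, pure_ext v w /\ forall a, possible r s w a -> good r s w a.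
Proof.
have [|f [f0 fP]] := @dependent_sequence seq_node (fun=> True)
  (fun a x y => pure_ext x y /\ (possible r s y a -> good r s x a)) v I.
  move=> a x _; have [gx|ngx] := pselect (good r s x a).
    by exists x; split=> //; split=> //; exact: pure_ext_refl.
  have [y /not_implyP[xy npy]] : exists y, ~ (pure_ext x y -> possible r s y a).
    by apply/existsNP => xP; apply: ngx => y /xP.
  by exists y.
have [|w wP] := @pure_ext_sup f; first by move=> i; case: (fP i) => _ [].
exists w; split=> [|a /(possible_anti (wP a.+1)) pa]; first by rewrite -f0.
by have [_ [_ /(_ pa)]] := fP a; apply: good_mono.
Qed.

(** One chain of pure extensions makes the next move for every colour of [A] in turn; moves made
    early remain good at the union. *)
Lemma good_extend_all r (U : nat -> seq omega1) v (A : set nat) :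
  (forall a, A a -> good r.+1 (U a) v a) ->
  exists w h, pure_ext v w /\ forall a, A a ->
    [/\ (len v <= h a)%O, (h a < len w)%O & good r (rcons (U a) (h a)) w a].
Proof.
move=> gU; have [||f [f0 fP]] := @dependent_sequence seq_node (pure_ext v)
  (fun a x y => pure_ext x y /\ (A a -> exists h,
    [/\ (len v <= h)%O, (h < len y)%O & good r (rcons (U a) h) y a])) v.
- exact: pure_ext_refl.
- move=> a x vx; have [Aa|nAa] := pselect (A a); last first.
    by exists x; split=> //; split=> //; exact: pure_ext_refl.
  have [y [h [xy xh hy gy]]] := gU a Aa x vx.
  exists y; split; first exact: pure_ext_trans xy.
  split=> // _; exists h; split=> //; exact: le_trans (pure_ext_len vx) xh.
have [|w wP] := @pure_ext_sup f; first by move=> i; case: (fP i) => _ [].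
have [h hP] : {h : nat -> omega1 & forall a, A a ->
    [/\ (len v <= h a)%O, (h a < len w)%O & good r (rcons (U a) (h a)) w a]}.
  apply: (@choice _ _ (fun a h => A a ->
    [/\ (len v <= h)%O, (h < len w)%O & good r (rcons (U a) h) w a])) => a.
  have [Aa|nAa] := pselect (A a); last by exists ozero.
  have [_ [_ /(_ Aa)[h [vh hf gh]]]] := fP a; exists h => _; split=> //.
    exact: lt_le_trans hf (pure_ext_len (wP a.+1)).
  exact: good_mono gh.
by exists w, h; split=> //; rewrite -f0.
Qed.

Lemma good_complete r s v a : good r s v a ->
  exists u s', [/\ pure_ext v u, c u = a, codes_tuple m u (s ++ s'), size s' = r
    & forall x, x \in s' -> (len v <= x)%O].
Proof.
elim: r s v => [|r IH] s v /good_possible.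
  by move=> [u [vu us ua]]; exists u, [::]; rewrite cats0; split.
move=> [w [h [vw vh hw /IH[u [s' [wu ua us s'r s'P]]]]]].
exists u, (h :: s'); rewrite -cat_rcons /= s'r; split=> //; first exact: pure_ext_trans wu.
move=> x; rewrite inE => /orP[/eqP -> //|/s'P]; exact: le_trans (pure_ext_len vw).
Qed.

(* Stage [j]: [s] holds the first [j] entries of the tuple of the node under
   construction, and [U a] the first [j - k] entries reserved for the colour [a]. *)
Record interleaving (A : set nat) (j : nat) (v : seq_node) (s : seq omega1)
    (U : nat -> seq omega1) : Prop := Interleaving {
  il_size : size s = j;
  il_sorted : sorted <%O s;
  il_lt : forall x, x \in s -> (x < len v)%O;
  il_good : forall a w, pure_ext v w -> good (m - j) s w a -> A a;
  il_sizeU : forall a, size (U a) = j - k;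
  il_goodU : forall a, A a -> good (m - (j - k)) (U a) v a;
  il_ltU : forall a x, A a -> x \in U a -> (x < len v)%O;
  il_lo : forall a i, A a -> i + k < j -> (nth ozero s (i + k) < nth ozero (U a) i)%O;
  il_hi : forall a i, A a -> i + k.+1 < j -> (nth ozero (U a) i < nth ozero s (i + k.+1))%O
}.

(** The new entry of [s] is the length [t] of a node deciding the colours possible after [s]. The
    next reserved entries, if due, are chosen above [t]. *)
Lemma interleaving_step A j v s U : interleaving A j v s U -> j < m ->
  exists v' s' U', interleaving A j.+1 v' s' U'.
Proof.
move=> il jm; have [w [vw wP]] := deciding_ext (m - j) s v.
(* The extra empty entry puts the position [t] inside the domain of [v1]. *)
pose t := len w; pose v1 := snoc w [::].
have wv1 : pure_ext w v1 by apply: pure_ext_snoc => //; exact: pure_ext_refl.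
have tv1 : (t < len v1)%O by rewrite len_snoc ltoS.
have vv1 : pure_ext v v1 by exact: pure_ext_trans wv1.
have vt : (len v <= t)%O by exact: pure_ext_len.
have ss' : sorted <%O (rcons s t).
  have := il_sorted il; case: s {wP} il => //= x s il; rewrite rcons_path => ->.
  by rewrite (lt_le_trans _ vt) //; apply: (il_lt il); exact: mem_last.
have s'P x : x \in rcons s t -> (x < len v1)%O.
  rewrite mem_rcons inE => /orP[/eqP -> //|/(il_lt il)] xv.
  exact: lt_le_trans xv (pure_ext_len vv1).
(* Goodness after the move [t] makes the colour possible before it; since [w] decides, it was
   already good there. *)
have goodA a x : pure_ext v1 x -> good (m - j.+1) (rcons s t) x a -> A a.
  move=> v1x gx; apply: (il_good il vw); apply: wP; rewrite -(subnSK jm).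
  exists x, t; split=> //; first exact: pure_ext_trans v1x.
  exact: lt_le_trans tv1 (pure_ext_len v1x).
have nth_s i : i < j -> nth ozero (rcons s t) i = nth ozero s i.
  by move=> ij; rewrite nth_rcons (il_size il) ij.
have nth_t : nth ozero (rcons s t) j = t.
  by rewrite nth_rcons (il_size il) ltnn eqxx.
have [jk|kj] := ltnP j k.
  exists v1, (rcons s t), U; split=> //.
  - by rewrite size_rcons (il_size il).
  - by move=> a; rewrite (il_sizeU il); lia.
  - move=> a Aa; apply: good_mono vv1 _; have := il_goodU il Aa.
    by have -> : j - k = j.+1 - k by lia.
  - by move=> a x Aa /(il_ltU il Aa) xv; apply: lt_le_trans xv (pure_ext_len vv1).
  - by move=> a i _; lia.
  - by move=> a i _; lia.
have rE : m - (j - k) = (m - (j.+1 - k)).+1 by lia.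
have [|v2 [h [v12 hP]]] := @good_extend_all (m - (j.+1 - k)) U v1 A.
  by move=> a Aa; rewrite -rE; apply: good_mono vv1 _; exact: (il_goodU il Aa).
have sU a : size (U a) = j - k := il_sizeU il a.
exists v2, (rcons s t), (fun a => rcons (U a) (h a)); split=> //.
- by rewrite size_rcons (il_size il).
- by move=> x /s'P xv1; exact: lt_le_trans xv1 (pure_ext_len v12).
- by move=> a x v2x; apply: goodA; exact: pure_ext_trans v2x.
- by move=> a; rewrite size_rcons sU; lia.
- by move=> a /hP[].
- move=> a x Aa; rewrite mem_rcons inE => /orP[/eqP ->|/(il_ltU il Aa) xv].
    by have [] := hP _ Aa.
  exact: lt_le_trans xv (pure_ext_len (pure_ext_trans vv1 v12)).
(* A reserved entry added now is at least [len v1], hence above [t]; those added earlier lie below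
   [len v], hence below [t]. *)
- move=> a i Aa; rewrite ltnS leq_eqVlt => /orP[/eqP ikj|ikj].
    rewrite ikj nth_t nth_rcons sU; have -> : i = j - k by lia.
    by rewrite ltnn eqxx; have [v1h _ _] := hP _ Aa; exact: lt_le_trans v1h.
  by rewrite nth_s // nth_rcons sU ifT; [exact: (il_lo il Aa)|lia].
- move=> a i Aa; rewrite ltnS leq_eqVlt => /orP[/eqP ikj|ikj].
    rewrite ikj nth_t nth_rcons sU ifT; last by lia.
    apply: lt_le_trans vt; apply: (il_ltU il Aa); apply: mem_nth; rewrite sU; lia.
  by rewrite nth_s // nth_rcons sU ifT; [exact: (il_hi il Aa)|lia].
Qed.

Lemma interleaving_exists : exists A v s U, interleaving A m v s U.
Proof.
have [o _] := omega1_zero.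
have [w [_ wP]] := deciding_ext m [::] (mknode o (fun=> 0)).
pose A : set nat := good m [::] w; exists A.
suff /(_ m (leqnn m)) : forall j, j <= m -> exists v s U, interleaving A j v s U by [].
elim=> [_|j IH jm]; last first.
  have [v [s [U il]]] := IH (ltnW jm); exact: interleaving_step il jm.
exists w, [::], (fun=> [::]); split=> //.
- move=> a w' ww'; rewrite subn0 => /good_possible/(possible_anti ww'); exact: wP.
- by move=> a; rewrite subn0.
Qed.

(** After writing the record of [s] at [rho], stage [n] completes [U n] to a node [u n] of colour
    [n] if [n] is in [A], then writes at [len (u n)] pointers to [rho] and to all earlier ladder
    positions. The union [t] thus points to each of them cofinally. *)
Lemma ladder_node_exists A v s U : 0 < k -> k < m -> interleaving A m v s U ->
  exists t, A (c t) /\ forall a, A a -> exists2 u, ladder_child k m t u & c u = a.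
Proof.
move=> k0 km il; have [w [vw wP]] := deciding_ext 0 s v.
have goodU x a : A a -> pure_ext w x -> good k (U a) x a.
  move=> Aa wx; apply: good_mono (pure_ext_trans vw wx) _.
  by have := il_goodU il Aa; have -> : m - (m - k) = k by lia.
pose rho := len w; pose v0 := snoc w [seq (i.+2, nth ozero s i) | i <- iota 0 m].
pose marks (l : seq omega1) := (1, rho) :: [seq (0, g) | g <- l].
have sw i : i < m -> (nth ozero s i < len w)%O.
  move=> im; apply: lt_le_trans (pure_ext_len vw); apply: (il_lt il).
  by rewrite mem_nth // (il_size il).
have reclt p : p \in [seq (i.+2, nth ozero s i) | i <- iota 0 m] -> (p.2 < len w)%O.
  by move=> /mapP[i]; rewrite mem_iota add0n => /andP[_ im] -> /=; exact: sw.
have wv0 : pure_ext w v0.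
  apply: pure_ext_snoc => //; first exact: pure_ext_refl.
  by move=> p /mapP[i _ ->].
have marksP l p : p \in marks l -> p.2 = rho \/ p.2 \in l.
  by rewrite inE => /orP[/eqP ->|/mapP[g gl ->]]; [left|right].
pose P (x : seq_node * seq omega1) := [/\ pure_ext w x.1, (rho < len x.1)%O
  & forall g, g \in x.2 -> (rho <= g)%O /\ (g < len x.1)%O].
pose R n (x y : seq_node * seq omega1) := exists u s', [/\ pure_ext x.1 u,
  y = (snoc u (marks x.2), rcons x.2 (len u)),
  A n -> c u = n, A n -> codes_tuple m u (U n ++ s')
  & A n -> size s' = k /\ forall g, g \in s' -> (len x.1 <= g)%O].
have marks_lt x u : P x -> pure_ext x.1 u ->
    forall p, p \in marks x.2 -> (p.2 < len u)%O.
  move=> [wx rx xP] xu p /marksP[->|/xP[_ px]];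
    [exact: lt_le_trans rx (pure_ext_len xu)|exact: lt_le_trans px (pure_ext_len xu)].
have [||f [f0 fP]] := @dependent_sequence _ P R (v0, [::]).
- by split=> //=; rewrite len_snoc ltoS.
- move=> n x Px; have [wx rx xP] := Px.
  have [u [s' [xu ucn uU s'P]]] : exists u s', [/\ pure_ext x.1 u, A n -> c u = n,
      A n -> codes_tuple m u (U n ++ s')
    & A n -> size s' = k /\ forall g, g \in s' -> (len x.1 <= g)%O].
    have [An|nAn] := pselect (A n).
      have [u [s' [xu uc us s'k s'x]]] := good_complete (goodU _ _ An wx).
      by exists u, s'; split.
    (* For a colour outside [A] the stage adds only a mark at the current length. *)
    by exists x.1, [::]; split=> //; exact: pure_ext_refl.
  exists (snoc u (marks x.2), rcons x.2 (len u)); split; last by exists u, s'; split.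
  have wu := pure_ext_trans wx xu.
  have mlt := marks_lt _ _ Px xu; split=> /=.
  + apply: pure_ext_snoc => // p /marksP[->//|/xP[]//].
  + by rewrite len_snoc ltoS ltW // (lt_le_trans rx) // pure_ext_len.
  + move=> g; rewrite mem_rcons inE len_snoc ltoS => /orP[/eqP ->|/xP[rg gx]].
      by split; [exact: pure_ext_len|].
    by split=> //; rewrite ltW // (lt_le_trans gx) // pure_ext_len.
have Pf n : P (f n) by case: (fP n).
have /choice[u uP] : forall n, exists u s', [/\ pure_ext (f n).1 u,
  f n.+1 = (snoc u (marks (f n).2), rcons (f n).2 (len u)),
  A n -> c u = n, A n -> codes_tuple m u (U n ++ s')
  & A n -> size s' = k /\ forall g, g \in s' -> (len (f n).1 <= g)%O].
  by move=> n; case: (fP n).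
have fu n : pure_ext (f n).1 (u n) by have [s' []] := uP n.
have fS n : f n.+1 = (snoc (u n) (marks (f n).2), rcons (f n).2 (len (u n))).
  by have [s' []] := uP n.
have ult n : (len (u n) < len (f n.+1).1)%O by rewrite fS /= len_snoc ltoS.
have fSP n : (len (f n).1 <= len (f n.+1).1)%O /\
    forall a, (a < len (f n).1)%O -> entry (f n).1 a = entry (f n.+1).1 a.
  have [fle fE _] := fu n; rewrite fS /= len_snoc; split=> [|a af].
    by apply: le_trans fle _; rewrite ltW // ltoS.
  by rewrite entry_snoc ?(lt_le_trans af) // fE.
have [t [tle tE tlt]] := seq_node_sup fSP.
have fmono n n' : n <= n' -> (len (f n).1 <= len (f n').1)%O.
  move=> /subnKC <-; elim: (n' - n) => [|d IH]; first by rewrite addn0.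
  by rewrite addnS; apply: le_trans IH (fSP _).1.
have fult n : (len (f n).1 <= len (u n))%O by exact: pure_ext_len.
have utlt n : (len (u n) < len t)%O by exact: lt_le_trans (ult n) (tle _).
have ftlt n : (len (f n).1 < len t)%O by exact: le_lt_trans (fult n) (utlt n).
have lmono g n n' : n <= n' -> g \in (f n).2 -> g \in (f n').2.
  move=> /subnKC <-; elim: (n' - n) => [|d IH]; first by rewrite addn0.
  by move=> /IH gf; rewrite addnS fS /= mem_rcons inE gf orbT.
have lold g n n' : g \in (f n').2 -> (g < len (f n).1)%O -> g \in (f n).2.
  have [n'n|nn' gf gn] := leqP n' n; first by move=> gf _; exact: lmono gf.
  move: gf; rewrite -(subnKC (ltnW nn')); elim: (n' - n) => [|d IH]; first by rewrite addn0.
  rewrite addnS fS /= mem_rcons inE => /orP[/eqP gE|//].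
  have := le_trans (fmono _ _ (leq_addr d n)) (fult (n + d)).
  by rewrite -gE leNgt gn.
have tpoints n i g : points t (len (u n)) i g <-> (i, g) \in marks (f n).2.
  have fS1 : (f n.+1).1 = snoc (u n) (marks (f n).2) by rewrite fS.
  rewrite -(points_snoc i g (marks_lt _ _ (Pf n) (fu n))) -fS1.
  by split; apply: eq_points; rewrite (tE n.+1).
have target i g : i < 2 -> limit_target t i g <-> exists n, (i, g) \in marks (f n).2.
  move=> i2; split=> [ig|[n ign] d dt]; last first.
    have [n1 dn1] := tlt d dt; exists (len (u (maxn n n1))); split=> //.
      by rewrite ltW // (lt_le_trans dn1) // (le_trans _ (fult _)) // fmono // leq_maxr.
    apply/tpoints; move: ign; rewrite !inE => /orP[->//|/mapP[h hl ->]].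
    by apply/orP; right; apply/mapP; exists h => //; apply: lmono hl; exact: leq_maxl.
  (* Take a stage [n0] longer than [g] and a later position pointing to [g]. It is either a mark or
     lies inside the pure extension [u n], where a pointer to [g] would cross the preceding
     stage. *)
  have [b [_ bt [gb _]]] := ig _ (ftlt 0).
  have [n0 gn0] := tlt _ (lt_trans gb bt).
  have [a [n0a at_ pg]] := ig _ (ftlt n0).
  have [n [n0n na an]] : exists n,
      [/\ n0 <= n, (len (f n).1 <= a)%O & (a < len (f n.+1).1)%O].
    have [N aN] := tlt _ at_; elim: N aN => [|N IH] aN.
      by have := lt_le_trans aN (fmono 0 n0 isT); rewrite ltNge n0a.
    have [/IH//|Na] := ltP a (len (f N).1); exists N; split=> //.
    rewrite leqNgt; apply/negP => /fmono Nn0.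
    by have := lt_le_trans aN Nn0; rewrite ltNge n0a.
  exists n; move: an; rewrite fS /= len_snoc ltoS le_eqVlt => /orP[/eqP aE|au].
    by apply/tpoints; rewrite -aE.
  have [_ _ /(_ a i g i2 na au)] := fu n.
  have -> : (len (f n).1 <= g)%O = false.
    by apply/negbTE; rewrite -ltNge (lt_le_trans gn0) // fmono.
  suff pu : points (u n) a i g by move=> /(_ pu).
  apply: eq_points pg; rewrite -(tE n.+1); last by rewrite fS /= len_snoc ltoS ltW.
  by rewrite fS /= entry_snoc.
have target0 g : limit_target t 0 g <-> exists n, g \in (f n).2.
  rewrite target //; split=> -[n gn]; exists n; last first.
    by rewrite !inE; apply/orP; right; apply/mapP; exists g.
  by move: gn; rewrite !inE => /orP[//|/mapP[h hl []->]].
have target1 g : limit_target t 1 g <-> g = rho.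
  rewrite target //; split=> [[n]|->]; last by exists 0; rewrite inE eqxx.
  by rewrite inE => /orP[/eqP[]//|/mapP[h]].
have wt : pure_ext w t.
  have wf n : pure_ext w (f n).1 by case: (Pf n).
  split=> [|a aw|a i g i2 wa at_ pg].
  - exact: le_trans (pure_ext_len (wf 0)) (tle 0).
  - have [wf0 wfE _] := wf 0.
    by rewrite wfE // (tE 0) // (lt_le_trans aw).
  - have [n an] := tlt _ at_; have [_ _ wfP] := wf n.
    by apply: (wfP a i g i2 wa an); apply: eq_points pg; rewrite (tE n).
have ts : codes_tuple m t s.
  split; [exact: il_size il|exact: il_sorted il|exists rho; split=> //].
    by have [_ r0 _] := Pf 0; exact: lt_trans r0 (ftlt 0).
  move=> i g im; have e0 : entry t rho = entry v0 rho.
    by rewrite -(tE 0) f0 //= len_snoc ltoS.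
  have -> : (g = nth ozero s i) <-> points v0 rho i.+2 g; last first.
    by split; apply: eq_points.
  rewrite points_snoc //; split=> [->|/mapP[j _ [<- ->]]//].
  by apply/mapP; exists i; rewrite // mem_iota.
exists t; split=> [|a Aa].
  (* [t] itself witnesses that its colour is possible over [w]; as [w] decides, the colour is good
     and so belongs to [A]. *)
  by apply: (il_good il vw); rewrite subnn; apply: wP; exists t; split.
have [s' [_ _ /(_ Aa) ca /(_ Aa) uU /(_ Aa)[s'k s's]]] := uP a.
have utE b : (b < len (u a))%O -> entry (u a) b = entry t b.
  by move=> bu; rewrite -(tE a.+1) ?(lt_trans bu) // fS /= entry_snoc.
have Um : size (U a) = m - k := il_sizeU il a.
have ms : size s = m := il_size il.
exists (u a) => //; exists s, (U a ++ s'); split=> //.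
- exact/seq_ltP.
- by apply/target0; exists a.+1; rewrite fS /= mem_rcons inE eqxx.
- move=> d /tlt[n dn]; apply: (sub_finite_set _ (finite_seq (f n).2)) => g /= [gd].
  by move=> /target0[n' gn']; apply: lold gn' _; exact: lt_trans dn.
(* Interleaving constrains only the first [m - k] entries, which are exactly [U a]. *)
- move=> j jk; rewrite nth_cat Um ifT; last by lia.
  split=> [|jk1]; first exact: (il_lo il Aa).
  exact: (il_hi il Aa).
- have [_ r0 _] := Pf a; apply: lt_trans (lt_le_trans r0 (fult a)); apply: sw; lia.
(* As [k] is positive, the last entry of the tuple belongs to [s'], chosen above [(f a).1] and hence
   above all earlier ladder positions. *)
- move=> g /target0[n gn] gu.
  have : g \in (f a.+1).2 by apply: lold gn _; exact: lt_trans (ult a).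
  rewrite fS /= mem_rcons inE => /orP[/eqP gE|ga]; first by rewrite gE ltxx in gu.
  have [_ _ /(_ _ ga)[_ gfa]] := Pf a; apply: lt_le_trans gfa _; apply: s's.
  by rewrite nth_cat Um ifF; [apply: mem_nth; rewrite s'k; lia|lia].
Qed.

Lemma monochromatic_edge : 0 < k -> k < m ->
  exists t u, ladder_child k m t u /\ c u = c t.
Proof.
move=> k0 km; have [A [v [s [U il]]]] := interleaving_exists.
have [t [At tP]] := ladder_node_exists k0 km il.
by have [u tu cu] := tP _ At; exists t, u.
Qed.

End Colouring.

(** * Chromatic number and choice of parameters *)

Lemma ladder_graph_hajnal_mate k m : 0 < k -> k < m -> hajnal_mate (ladder_graph k m).
Proof.
move=> k0 km.
have adj_len (s t : seq_tree) : adj (ladder_graph k m) s t -> len s <> len t.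
  by case=> /down_lt/seq_ltP[lt_st _] E; rewrite E ltxx in lt_st.
split; last by move=> a b ab t; exact: ladder_graph_finite ab.
  by move=> s t [/down_lt|/down_lt]; [right|left].
(* The length is a proper colouring by [omega1]; a countable colouring would yield one by [nat],
   contradicting [monochromatic_edge]. *)
exists omega1; split; last exact: omega1_uncountable.
split=> [|N [c cP]]; first by exists len.
apply: omega1_card_le => /countable_injP[h hinj].
have [t [u [tu /hinj cE]]] := monochromatic_edge (h \o c) k0 km.
by apply: (cP u t); [right|apply: cE; rewrite inE].
Qed.

Theorem theorem3p6 (s : nat) :
  exists G : graph seq_tree,
    [/\ hajnal_mate G,
        special_cycle_free G
      & ~ exists (n : nat) (x : 'I_n -> seq_tree),
            [/\ is_cycle G x, odd n & n <= 2 * s + 1]].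
Proof.
(* The successor keeps [k] positive when [s = 0]; [m] is just large enough to track indices along
   closed walks of length up to 2k+1. *)
pose k := s.+1; pose m := (2 * (k.+1 * (2 * k + 1))).+1.
have km : k < m by rewrite /m; nia.
exists (ladder_graph k m); split; first exact: ladder_graph_hajnal_mate.
  exact: ladder_graph_special_cycle_free.
move=> [n [x [xcyc oddn ns]]]; have nk : n <= 2 * k + 1 by rewrite /k; lia.
apply: (ladder_graph_no_odd_cycle xcyc oddn nk).
by rewrite ltnS !leq_mul2l nk orbT.
Qed.
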